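(* Let $0 < \varepsilon \leq 1$. There exist $n_0(\varepsilon)$ and a constant $c > 0$ such that the following holds. Let $A$ be a set of $n > n_0(\varepsilon)$ positive real numbers, any two distinct elements of which differ by at least $1$. For each pair $(a,b) \in A \times A$ let $\delta_{a,b}$ and $\delta'_{a,b}$ be arbitrary real numbers satisfying $$|\delta_{a,b}| < \frac{n^{1-\varepsilon}}{a}, \qquad |\delta'_{a,b}| < \frac{n^{1-\varepsilon}}{b}.$$ Define the perturbed product set $$P := \{ (a + \delta_{a,b})(b + \delta'_{a,b}) : a,b \in A\}.$$ Then $$|P| + |A+A| \geq c\,\frac{n^{1+\varepsilon/9}}{\log n}.$$
   Context: $A+A = \{a+b : a,b \in A\}$ is the sumset and $|\cdot|$ denotes cardinality. $\log$ is the natural logarithm. *)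

(* Defs.v *)
From HB Require Import structures.
From mathcomp Require Import all_boot all_order all_algebra.
From mathcomp Require Import finmap.
From mathcomp Require Import all_classical all_reals all_analysis.

Set Implicit Arguments.
Unset Strict Implicit.
Unset Printing Implicit Defensive.

Import Order.TTheory GRing.Theory Num.Theory.
Local Open Scope fset_scope.
Local Open Scope ring_scope.

Definition sumset (R : realType) (A : {fset R}) : {fset R} :=
  [fset a + b | a in A, b in A].

(* Perturbations are total functions on R * R; only their values on A * A
   enter the definition. *)
Definition perturbed_product (R : realType) (A : {fset R})
    (delta delta' : R -> R -> R) : {fset R} :=
  [fset (a + delta a b) * (b + delta' a b) | a in A, b in A].

(* Main.v *)
Require Import Defs.
From HB Require Import structures.
From mathcomp Require Import all_boot all_order all_algebra.
From mathcomp Require Import finmap.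
From mathcomp Require Import all_classical all_reals all_analysis.
From mathcomp Require Import zify ring lra.

Set Implicit Arguments.
Unset Strict Implicit.
Unset Printing Implicit Defensive.

Import Order.TTheory GRing.Theory Num.Theory.
Local Open Scope fset_scope.
Local Open Scope ring_scope.

(* Let [D = n^(1-eps)], let [U] and [L] be the larger and the smaller half of
   [A], and let [x] be a most popular sum in [U + L].  The set [B] of the
   [a] in [U] with [x - a] in [L] satisfies [|B| |A+A| >= n^2/8] and lies in
   [[x/2, x]], so on [B] the perturbed product [q (a, b)] differs from [a * b] by
   [O(D)] and is strictly increasing in each variable.

   Let [b_1 < ... < b_N] be the elements of [B], as in Solymosi's
   consecutive-element argument.  For at least half of the triples [(i, j, k)],
   [b_i + b_j] and [b_{i+1} + b_j] are [O(|A+A|/N)] places apart in [A+A], and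
   [q (b_i, b_k)] and [q (b_{i+1}, b_k)] are [O(|P|/N)] places apart in [P].  These
   four numbers determine [b_k] up to [O(D)], hence [k] up to [O(D)] choices, and
   then determine [i] and [j].  Thus [N^5 = O(|A+A|^2 |P|^2 D)], and
   eliminating [N] gives [n^(9+eps) = O(|A+A|^7 |P|^2)], which is stronger than
   the claim by the factor [ln n]. *)

(** * Counting triples of indices by consecutive gaps *)

(** The gaps telescope to at most [f M], and each gap counted contributes at least [G.+1]. *)
Lemma sum_lt_consecutive_gaps (M s G : nat) (f : nat -> nat) :
  (forall i, i < M -> f i <= f i.+1)%N -> (f M < s)%N ->
  (#|[set i : 'I_M | G < f i.+1 - f i]| * G.+1 <= s)%N.
Proof.
move=> f_mono fM; apply: leq_trans (ltnW fM).
have : (\sum_(i < M) (f i.+1 - f i) <= f M)%N.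
  have -> : (\sum_(i < M) (f i.+1 - f i) = \sum_(0 <= i < M) (f i.+1 - f i))%N.
    by rewrite big_mkord.
  elim: M f_mono {fM} => [|M IH] fm; first by rewrite big_geq.
  rewrite big_nat_recr //=; have := IH (fun i h => fm i (ltnW h)).
  have := fm M (ltnSn M); lia.
apply: leq_trans.
rewrite -sum_nat_const [X in (X <= _)%N]big_mkcond /=.
by apply: leq_sum => i _; rewrite inE; case: ltnP.
Qed.

Lemma card_pair_const (I J : finType) (Q : {set I * J}) (m : nat) :
  (forall j, m <= #|[set i | (i, j) \in Q]|)%N -> (#|J| * m <= #|Q|)%N.
Proof.
move=> H; rewrite -sum_nat_const -sum1_card.
have -> : (\sum_(x in Q) 1 = \sum_(j : J) #|[set i | (i, j) \in Q]|)%N.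
  under [RHS]eq_bigr do rewrite -sum1dep_card.
  rewrite (exchange_big_dep predT) //= pair_big_dep /=.
  by apply: eq_bigl => -[i j].
exact: leq_sum.
Qed.

(** A triple with small gaps is encoded by the values and gaps of [f] and [g] and by [k] modulo [K];
    the last hypothesis makes this code injective. At least half of about [N ^ 3] triples thus share
    [O(s * (s / N) * p * (p / N) * K)] codes. *)
Lemma consecutive_count (N s p K : nat) (f g : nat -> nat -> nat) :
  (0 < K)%N ->
  (forall i j, i < N -> j < N -> f i j < s)%N ->
  (forall i j, i.+1 < N -> j < N -> f i j < f i.+1 j)%N ->
  (forall i j, i < N -> j < N -> g i j < p)%N ->
  (forall i j, i.+1 < N -> j < N -> g i j < g i.+1 j)%N ->
  (forall i j k i' j' k', i.+1 < N -> j < N -> k < N ->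
     i'.+1 < N -> j' < N -> k' < N ->
     f i j = f i' j' -> f i.+1 j = f i'.+1 j' ->
     g i k = g i' k' -> g i.+1 k = g i'.+1 k' ->
     k = k' %[mod K] -> [/\ i = i', j = j' & k = k'])%N ->
  (N ^ 5 <= 400 * (s ^ 2 * p ^ 2 * K))%N.
Proof.
move=> K0 fs fmono gp gmono inj.
have [N0|N0] := posnP N; first by rewrite N0.
have [s0 p0] : (0 < s)%N /\ (0 < p)%N.
  by have := fs 0 0 N0 N0; have := gp 0 0 N0 N0; lia.
case: N N0 => // M _ in fs fmono gp gmono inj *.
have [->|M0] := posnP M; first by rewrite exp1n !muln_gt0 /= s0 p0 K0.
have grow (u : nat -> nat) (m : nat) :
    (forall i, i < M -> u i < u i.+1)%N -> (u M < m)%N -> (M <= m)%N.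
  move=> um uM; suff : (M <= u M)%N by lia.
  have : (forall i, i <= M -> i <= u i)%N; last exact.
  by elim=> // i IH iM; have := um i iM; have := IH (ltnW iM); lia.
(* These two bounds absorb the extra [M] caused by rounding in [G_le] and [H_le]. *)
have Ms : (M <= s)%N.
  by apply: (grow (f^~ 0%N)) => [i iM|]; [apply: fmono|apply: fs].
have Mp : (M <= p)%N.
  by apply: (grow (g^~ 0%N)) => [i iM|]; [apply: gmono|apply: gp].
(* For each [j], at most a quarter of the [i] have an [f]-gap above [G], and likewise for [g] and
   [H]; so at least half of the [i] survive for every pair [(j, k)]. *)
pose G := (4 * s %/ M)%N; pose H := (4 * p %/ M)%N.
have G_le : (G.+1 * M <= 5 * s)%N.
  by have := leq_divM (4 * s) M; rewrite -/G; nia.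
have H_le : (H.+1 * M <= 5 * p)%N.
  by have := leq_divM (4 * p) M; rewrite -/H; nia.
have few (u : nat -> nat -> nat) (m j : nat) :
    (forall i j, i < M.+1 -> j < M.+1 -> u i j < m)%N ->
    (forall i j, i.+1 < M.+1 -> j < M.+1 -> u i j < u i.+1 j)%N ->
    (j < M.+1)%N ->
    (4 * #|[set i : 'I_M | 4 * m %/ M < u i.+1 j - u i j]| <= M)%N.
  move=> um umono jM.
  have := @sum_lt_consecutive_gaps M m (4 * m %/ M)%N (u^~ j) _ _.
  move=> /(_ (fun i iM => ltnW (umono i j iM jM)) (um _ _ (ltnSn M) jM)).
  have : (4 * m < (4 * m %/ M).+1 * M)%N by rewrite ltn_ceil.
  move: (4 * m %/ M)%N #|_| => q r; nia.
pose good : {set 'I_M * ('I_M.+1 * 'I_M.+1)} :=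
  [set t : 'I_M * ('I_M.+1 * 'I_M.+1) | (f t.1.+1 t.2.1 - f t.1 t.2.1 <= G)%N
           && (g t.1.+1 t.2.2 - g t.1 t.2.2 <= H)%N].
have good_ge : (M.+1 ^ 2 * M <= 2 * #|good|)%N.
  suff /card_pair_const : forall jk, (uphalf M <= #|[set i | (i, jk) \in good]|)%N.
    rewrite card_prod !card_ord; have := leq_uphalf_double M (uphalf M).
    rewrite leqnn; move: (uphalf M) #|good| => q r; nia.
  case=> j k; set Q := [set i | _].
  have := few f s j fs fmono (ltn_ord j); have := few g p k gp gmono (ltn_ord k).
  set Bg := [set i | _]; set Bf := [set i | _].
  have : ([set: 'I_M] \subset Q :|: (Bf :|: Bg)).
    apply/fintype.subsetP => i _; rewrite !inE /= -/G -/H.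
    by rewrite (leqNgt _ G) (leqNgt _ H); do 2!case: (_ < _)%N.
  move/subset_leq_card; rewrite cardsT card_ord.
  have := (leq_card_setU Q (Bf :|: Bg)).1; have := (leq_card_setU Bf Bg).1.
  rewrite leq_uphalf_double; move: #|_| #|_| #|_| #|_| #|_| => x y z t u; lia.
case: s => // s in s0 fs Ms G G_le good good_ge few *.
case: p => // p in p0 gp Mp H H_le good good_ge few *.
case: K => // K in K0 inj *.
(* [inord] has a default value out of range, but on [good] every coordinate is in range, so equal
   codes have equal entries. *)
pose F (t : 'I_M * ('I_M.+1 * 'I_M.+1)) :
    'I_s.+1 * 'I_G.+1 * ('I_p.+1 * 'I_H.+1) * 'I_K.+1 :=
  ((inord (f t.1 t.2.1), inord (f t.1.+1 t.2.1 - f t.1 t.2.1)),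
   (inord (g t.1 t.2.2), inord (g t.1.+1 t.2.2 - g t.1 t.2.2)),
   inord (t.2.2 %% K.+1)).
have F_inj : {in good &, injective F}.
  move=> [i [j k]] [i' [j' k']]; rewrite !inE /= => /andP[G1 H1] /andP[G2 H2].
  have inordE n (a b : nat) : (a < n.+1)%N -> (b < n.+1)%N ->
      inord a = inord b :> 'I_n.+1 -> a = b.
    by move=> an bn /(congr1 val); rewrite /= !inordK.
  have wi (u : 'I_M) : (u < M.+1)%N by apply: ltnW; rewrite ltnS ltn_ord.
  case=> /inordE e1 /inordE e2 /inordE e3 /inordE e4 /inordE e5.
  have {}e1 := e1 (fs _ _ (wi _) (ltn_ord _)) (fs _ _ (wi _) (ltn_ord _)).
  have {}e3 := e3 (gp _ _ (wi _) (ltn_ord _)) (gp _ _ (wi _) (ltn_ord _)).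
  have {}e2 := e2 G1 G2; have {}e4 := e4 H1 H2.
  have {}e5 := e5 (ltn_pmod _ K0) (ltn_pmod _ K0).
  have m1 := fmono i j (ltn_ord i) (ltn_ord j).
  have m2 := fmono i' j' (ltn_ord i') (ltn_ord j').
  have m3 := gmono i k (ltn_ord i) (ltn_ord k).
  have m4 := gmono i' k' (ltn_ord i') (ltn_ord k').
  (* The values at [i.+1] are recovered as value plus gap; monotonicity makes the truncated
     subtraction exact. *)
  have [] := inj i j k i' j' k' (ltn_ord i) (ltn_ord j) (ltn_ord k)
    (ltn_ord i') (ltn_ord j') (ltn_ord k') e1 _ e3 _ e5; [lia|lia|].
  by move=> /val_inj -> /val_inj -> /val_inj ->.
have := max_card (F @: good); rewrite (card_in_imset F_inj) !card_prod !card_ord => card_le.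
have M1 : (M.+1 <= 2 * M)%N by rewrite mul2n -addnn -addn1 leq_add2l.
(* The constant 400 is 8 from [(2 * M) ^ 3], times 2 from [good_ge], times 25 from [G_le] and
   [H_le]. *)
apply: (@leq_trans (M.+1 ^ 2 * (2 * M) ^ 3)).
  by rewrite (expnD _ 2 3) leq_mul2l leq_exp2r // M1 orbT.
rewrite (_ : _ * _ = 8 * M ^ 2 * (M.+1 ^ 2 * M))%N; last by ring.
apply: leq_trans (leq_mul (leqnn _) (leq_trans good_ge (leq_mul (leqnn 2) card_le))) _.
rewrite (_ : (8 * M ^ 2 * _ =
  16 * (s.+1 * p.+1 * K.+1) * ((G.+1 * M) * (H.+1 * M)))%N); last by ring.
apply: leq_trans (leq_mul (leqnn _) (leq_mul G_le H_le)) _.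
by rewrite (_ : (_ * _ = 400 * (s.+1 ^ 2 * p.+1 ^ 2 * K.+1))%N) //; ring.
Qed.

(** * Separated sequences, ranks and popular sums *)

Section SeparatedSets.
Variable R : realType.
Implicit Types (S P : {fset R}) (b : seq R) (x y E : R).

(** For [x] in [S], its index in the increasing enumeration; it turns real sums and products into
    the natural numbers required by [consecutive_count]. *)
Definition rank S x : nat := size [seq y <- S | y < x].

Lemma rank_ltn S x y : x \in S -> x < y -> (rank S x < rank S y)%N.
Proof.
move=> xS xy; rewrite /rank !size_filter.
have -> : count (< y) S =
    (count (fun z => (z < y)%R && ~~ (z < x)%R) S + count (< x)%R S)%N.
  rewrite -[LHS]size_filter -(count_predC (fun z : R => z < x)) !count_filter addnC.
  congr (_ + _)%N; apply: eq_count => z /=; first by rewrite andbC.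
  by case: (ltP z x) => //= zx; rewrite (lt_trans zx xy).
rewrite -[X in (X < _)%N]add0n ltn_add2r -has_count.
by apply/hasP; exists x; rewrite // xy ltxx.
Qed.

Lemma rank_lt_card S x : x \in S -> (rank S x < #|` S|)%N.
Proof.
move=> xS; apply: leq_trans (_ : (rank S (x + 1) <= _)%N).
  by apply: rank_ltn => //; rewrite ltrDl.
by rewrite /rank size_filter count_size.
Qed.

Lemma rank_inj S : {in S &, injective (rank S)}.
Proof.
move=> x y xS yS xy; case: (ltgtP x y) => // h.
  by have := rank_ltn xS h; rewrite xy ltnn.
by have := rank_ltn yS h; rewrite xy ltnn.
Qed.

(** A single transitive relation carries both the order and the unit gaps, so the property passes to
    subsequences. *)
Definition one_separated b := sorted (fun x y => x + 1 <= y) b.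

Lemma one_separated_nth b i j : one_separated b -> (i <= j < size b)%N ->
  nth 0 b i + (j - i)%:R <= nth 0 b j.
Proof.
move=> sb /andP[ij jb]; elim: j ij jb => [|j IH].
  by rewrite leqn0 => /eqP ->; rewrite subnn addr0.
rewrite leq_eqVlt => /orP[/eqP <-|]; first by rewrite subnn addr0.
rewrite ltnS => ij jb; have {}IH := IH ij (ltnW jb).
have /= h := sortedP 0 sb _ jb.
rewrite subSn // -natr1; lra.
Qed.

(* The differences [b_{i+1} - b_i] and [q (b_{i+1}, d) - q (b_i, d)] determine
   [d] up to an error [4 * E], because [b_{i+1} - b_i >= 1]. *)
Lemma sum_product_separated S P b (q : R -> R -> R) E (K : nat) :
  one_separated b ->
  {in b &, forall x y, x + y \in S} -> {in b &, forall x y, q x y \in P} ->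
  {in b &, forall x y, `|q x y - x * y| <= E} ->
  {in b, forall x, 2 * E < x} -> 4 * E < K%:R ->
  (size b ^ 5 <= 400 * (#|` S| ^ 2 * #|` P| ^ 2 * K))%N.
Proof.
move=> sb sumS qP qE b_gt EK.
have [b0|b0] := posnP (size b); first by rewrite b0.
have E0 : 0 <= E by apply: le_trans (qE _ _ (mem_nth 0 b0) (mem_nth 0 b0)).
have K0 : (0 < K)%N by rewrite -(ltr_nat R); apply: le_lt_trans EK; rewrite mulr_ge0.
have q_bnd x y : x \in b -> y \in b -> x * y - E <= q x y <= x * y + E.
  by move=> xb yb; have := qE _ _ xb yb; rewrite ler_norml => /andP[? ?]; apply/andP; split; lra.
(* The main term grows by at least [d], which exceeds the total error [2 * E]. *)
have q_monol x y d : x \in b -> y \in b -> d \in b -> x + 1 <= y -> q x d < q y d.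
  move=> xb yb db xy.
  have /andP[_ h1] := q_bnd _ _ xb db; have /andP[h2 _] := q_bnd _ _ yb db.
  have h3 := b_gt _ db; have : 0 <= (y - x - 1) * d by apply: mulr_ge0; lra.
  lra.
have nb i : (i < size b)%N -> nth 0 b i \in b by exact: mem_nth.
have sep1 i j : (i < j)%N -> (j < size b)%N -> nth 0 b i + 1 <= nth 0 b j.
  move=> ij jb; have := one_separated_nth sb (i := i) (j := j).
  rewrite (ltnW ij) jb => /(_ isT); apply: le_trans.
  by rewrite lerD2l ler1n subn_gt0.
have nth_inj i j : (i < size b)%N -> (j < size b)%N -> nth 0 b i = nth 0 b j -> i = j.
  move=> ib jb e; case: (ltngtP i j) => // ij; exfalso.
    by have := sep1 _ _ ij jb; rewrite e; lra.
  by have := sep1 _ _ ij ib; rewrite e; lra.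
have q_injl i j k : (i < size b)%N -> (j < size b)%N -> (k < size b)%N ->
    q (nth 0 b i) (nth 0 b k) = q (nth 0 b j) (nth 0 b k) -> i = j.
  move=> ib jb kb e; case: (ltngtP i j) => // ij.
    by have := q_monol _ _ _ (nb i ib) (nb j jb) (nb k kb) (sep1 _ _ ij jb); rewrite e ltxx.
  by have := q_monol _ _ _ (nb j jb) (nb i ib) (nb k kb) (sep1 _ _ ij ib); rewrite e ltxx.
apply: (@consecutive_count _ _ _ K
  (fun i j => rank S (nth 0 b i + nth 0 b j))
  (fun i k => rank P (q (nth 0 b i) (nth 0 b k)))) => //.
- by move=> i j ib jb; apply/rank_lt_card/sumS; apply: nb.
- move=> i j ib jb; apply: rank_ltn; first by apply: sumS; apply: nb => //; exact: ltnW.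
  by have := sep1 _ _ (ltnSn i) ib; lra.
- by move=> i j ib jb; apply/rank_lt_card/qP; apply: nb.
- move=> i j ib jb; have ib' := ltnW ib.
  by apply: rank_ltn; [apply: qP|apply: q_monol => //]; rewrite ?nb// sep1.
move=> i j k i' j' k' ib jb kb ib' jb' kb'.
have iw := ltnW ib; have iw' := ltnW ib'.
move=> /rank_inj -/(_ (sumS _ _ (nb _ iw) (nb _ jb)) (sumS _ _ (nb _ iw') (nb _ jb'))) e1.
move=> /rank_inj -/(_ (sumS _ _ (nb _ ib) (nb _ jb)) (sumS _ _ (nb _ ib') (nb _ jb'))) e2.
move=> /rank_inj -/(_ (qP _ _ (nb _ iw) (nb _ kb)) (qP _ _ (nb _ iw') (nb _ kb'))) e3.
move=> /rank_inj -/(_ (qP _ _ (nb _ ib) (nb _ kb)) (qP _ _ (nb _ ib') (nb _ kb'))) e4 e5.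
have close : `|nth 0 b k - nth 0 b k'| <= 4 * E.
  have /andP[a1 a2] := q_bnd _ _ (nb _ iw) (nb _ kb).
  have /andP[a3 a4] := q_bnd _ _ (nb _ ib) (nb _ kb).
  have /andP[a5 a6] := q_bnd _ _ (nb _ iw') (nb _ kb').
  have /andP[a7 a8] := q_bnd _ _ (nb _ ib') (nb _ kb').
  have gap := sep1 _ _ (ltnSn i) ib.
  have t1 : 1 <= nth 0 b i.+1 - nth 0 b i by lra.
  (* Subtracting [e1] from [e2] cancels the [j] and [j'] terms, so both gaps agree. *)
  have te : nth 0 b i'.+1 = nth 0 b i' + (nth 0 b i.+1 - nth 0 b i).
    by move: e1 e2; lra.
  have : `|(nth 0 b i.+1 - nth 0 b i) * (nth 0 b k - nth 0 b k')| <= 4 * E.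
    rewrite -e3 in a5 a6; rewrite -e4 te in a7 a8.
    by rewrite ler_norml; apply/andP; split; lra.
  by apply: le_trans; rewrite normrM ler_peMl // ger0_norm; lra.
(* Unit separation gives [|k - k'| <= 4 * E < K], so congruence modulo [K] forces equality. *)
have kk' : k = k'.
  have wlog_lt u v : (u < v)%N -> (v < size b)%N -> u = v %[mod K] ->
      `|nth 0 b u - nth 0 b v| <= 4 * E -> False.
    move=> uv vb uvK h.
    have := one_separated_nth sb (i := u) (j := v); rewrite (ltnW uv) vb => /(_ isT) h'.
    have : (v - u < K)%N.
      rewrite -(ltr_nat R); move: h; rewrite ler_norml => /andP[h _]; lra.
    move=> vuK; have /dvdn_leq : (K %| v - u)%N by rewrite -eqn_mod_dvd ?uvK // ltnW.
    by rewrite subn_gt0 uv => /(_ isT); rewrite leqNgt vuK.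
  case: (ltngtP k k') => // lt; exfalso; first exact: wlog_lt lt kb' e5 close.
  by apply: wlog_lt lt kb (esym e5) _; rewrite distrC.
subst k'; have ii' := q_injl _ _ _ iw iw' kb e3; subst i'.
by split=> //; apply: nth_inj => //; apply: addrI e1.
Qed.

(** Averaging: each pair of [U] and [L] is counted in the fiber of its sum, so some fiber has at
    least average size. *)
Lemma popular_sum S (L U : seq R) : uniq L ->
  {in U & L, forall x y, x + y \in S} ->
  exists x, (size U * size L <= #|` S| * size [seq a <- U | (x - a)%R \in L])%N.
Proof.
move=> uL sumS.
have [/eqP|S0] := posnP #|` S|.
  rewrite cardfs_eq0 => /eqP S0; exists 0.
  case: U L {uL} sumS => [|u U] [|l L] //= sumS; rewrite ?muln0 //.
  by have := sumS u l (mem_head _ _) (mem_head _ _); rewrite S0 in_fset0.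
apply/not_existsP => H.
have : (size U * size L <= \sum_(x <- S) size [seq a <- U | (x - a)%R \in L])%N.
  under eq_bigr do rewrite size_filter -sum1_count big_mkcond.
  rewrite exchange_big /= -(sum1_size U) big_distrl /= big_seq [leqRHS]big_seq.
  apply: leq_sum => a aU; rewrite mul1n -big_mkcond sum1_count -size_filter.
  rewrite -(size_map (fun l => a + l) L) uniq_leq_size //.
    by rewrite map_inj_uniq //; exact: addrI.
  move=> _ /mapP[l lL ->]; rewrite mem_filter sumS // andbT.
  by rewrite addrC addKr.
rewrite leqNgt => /negP; apply.
rewrite -(ltn_pmul2l S0) big_distrr /=.
have {}H x : (#|` S| * size [seq a <- U | (x - a)%R \in L] < size U * size L)%N.
  by rewrite ltnNge; apply/negP => h; apply: (H x).
have Q0 := leq_trans (ltn0Sn _) (H 0).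
apply: leq_ltn_trans (_ : \sum_(x <- S) (size U * size L).-1 < _)%N.
  by apply: leq_sum => x _; rewrite -ltnS prednK.
rewrite big_const_seq count_predT iter_addn_0 [X in (_ < X)%N]mulnC ltn_pmul2r //.
by rewrite prednK.
Qed.
End SeparatedSets.

(** * Perturbation error and the two halves of [A] *)

(** Comparability of [a] and [b] bounds each cross term by [2 * D]; since [a * b >= n >= D], the
    term [u * v] is at most [D]. *)
Lemma product_error (R : realType) (D n a b u v : R) :
  16 <= n -> 1 <= D <= n -> n / 4 < a -> n / 4 < b -> a <= 2 * b -> b <= 2 * a ->
  `|u| < D / a -> `|v| < D / b -> `|(a + u) * (b + v) - a * b| <= 5 * D.
Proof.
move=> n16 /andP[D1 Dn] an bn ab ba hu hv.
have a0 : 0 < a by lra.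
have b0 : 0 < b by lra.
have ub : `|u * b| <= 2 * D.
  rewrite normrM (gtr0_norm b0); apply: le_trans (ler_wpM2r (ltW b0) (ltW hu)) _.
  by rewrite mulrAC ler_pdivrMr //; nra.
have va : `|v * a| <= 2 * D.
  rewrite normrM (gtr0_norm a0); apply: le_trans (ler_wpM2r (ltW a0) (ltW hv)) _.
  by rewrite mulrAC ler_pdivrMr //; nra.
have uv : `|u * v| <= D.
  rewrite normrM; apply: le_trans (ler_pM (normr_ge0 _) (normr_ge0 _) (ltW hu) (ltW hv)) _.
  rewrite mulrACA -invfM ler_pdivrMr ?mulr_gt0 // ler_wpM2l //; first lra.
  apply: le_trans Dn _; apply: le_trans (_ : 4 * (n / 4) <= _); first lra.
  by apply: ler_pM; lra.
have -> : (a + u) * (b + v) - a * b = u * b + v * a + u * v by ring.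
apply: le_trans (ler_normD _ _) _; have := ler_normD (u * b) (v * a); lra.
Qed.

Lemma sort_one_separated (R : realType) (A : {fset R}) :
  (forall a b, a \in A -> b \in A -> a != b -> 1 <= `|a - b|) ->
  one_separated (sort <=%R A).
Proof.
move=> sepA; apply/(sortedP 0) => i iA.
have := sort_sorted (@le_total _ R) A.
have uA : uniq (sort <=%R A) by rewrite sort_uniq fset_uniq.
move=> /(sortedP 0)/(_ i iA) le_i.
have memA j : (j < size (sort <=%R A))%N -> (sort <=%R A)`_j \in A.
  by move=> jA; rewrite -(mem_sort <=%R) mem_nth.
have := sepA _ _ (memA _ (ltnW iA)) (memA _ iA).
rewrite nth_uniq ?(ltnW iA) // neq_ltn ltnSn => /(_ isT).
by rewrite distrC ger0_norm ?subr_ge0 // lerBrDl.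
Qed.

(* Every sum of an element of the larger half [U] and an element of the smaller
   half [L] is at most twice the former, so the elements of [U] that represent a
   popular sum are within a factor of two of each other. *)
Lemma sum_product_popular_fiber (R : realType) (A : {fset R}) (delta delta' : R -> R -> R)
    (D : R) (K : nat) :
  let n := #|` A| in
  (16 <= n)%N -> 1 <= D <= n%:R -> 40 * D < n%:R -> 20 * D < K%:R ->
  (forall a, a \in A -> 0 < a) ->
  (forall a b, a \in A -> b \in A -> a != b -> 1 <= `|a - b|) ->
  (forall a b, a \in A -> b \in A ->
     `|delta a b| < D / a /\ `|delta' a b| < D / b) ->
  exists N : nat,
    (n ^ 2 <= 8 * (#|` sumset A| * N))%N /\
    (N ^ 5 <= 400 * (#|` sumset A| ^ 2 *
       #|` perturbed_product A delta delta'| ^ 2 * K))%N.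
Proof.
move=> n n16 D1n Dn DK posA sepA dA.
pose s := sort <=%R A; have ss : one_separated s := sort_one_separated sepA.
have size_s : size s = n by rewrite size_sort.
have s_mem x : (x \in s) = (x \in A) by rewrite mem_sort.
have us : uniq s by rewrite sort_uniq fset_uniq.
pose h := n./2.
have hn : (h <= n)%N by rewrite -(odd_double_half n) -addnn addnA leq_addl.
pose L := take h s; pose U := drop h s.
have LA x : x \in L -> x \in A by move=> /mem_take; rewrite s_mem.
have UA x : x \in U -> x \in A by move=> /mem_drop; rewrite s_mem.
have s_ge i : (i < n)%N -> i%:R < s`_i.
  move=> i_n; have := one_separated_nth ss (i := 0) (j := i); rewrite size_s i_n => /(_ isT).
  rewrite subn0; apply: lt_le_trans; rewrite ltrDr posA // -s_mem mem_nth //.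
  by rewrite size_s; apply: leq_ltn_trans i_n.
have s_le i j : (i <= j)%N -> (j < n)%N -> s`_i <= s`_j.
  move=> ij jn; have := one_separated_nth ss (i := i) (j := j).
  by rewrite ij size_s jn => /(_ isT); apply: le_trans; rewrite lerDl.
(* By [s_ge] an element exceeds its index, and indices in [U] are at least [n./2]. *)
have U_gt x : x \in U -> n%:R / 4 < x.
  move=> /(nthP 0)[i]; rewrite size_drop size_s => iU <-.
  rewrite nth_drop; apply: lt_trans (_ : (h + i)%:R < _); last by apply: s_ge; lia.
  rewrite ltr_pdivrMr // -natrM ltr_nat; rewrite /h; lia.
have LU x y : x \in L -> y \in U -> x <= y.
  move=> /(nthP 0)[i]; rewrite size_take size_s => iL <-.
  move=> /(nthP 0)[j]; rewrite size_drop size_s => jU <-.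
  have {}iL : (i < h)%N by move: iL; case: ifP; lia.
  by rewrite nth_take // nth_drop; apply: s_le; lia.
have sumS x y : x \in A -> y \in A -> x + y \in sumset A.
  by move=> xA yA; apply/imfset2P; exists x => //; exists y.
have [|x x_pop] := @popular_sum R (sumset A) L U (take_uniq _ us).
  by move=> x y /UA xA /LA yA; apply: sumS.
set B := [seq _ <- _ | _] in x_pop.
exists (size B); split.
  have : (n ^ 2 <= 8 * (size U * size L))%N.
    rewrite size_drop size_take size_s; case: ifP => _; rewrite /h; last by nia.
    have := odd_double_half n; case: (odd n); move: n./2 => m; nia.
  by move=> h1; apply: leq_trans h1 _; rewrite leq_mul2l.
have BU y : y \in B -> y \in U by rewrite mem_filter => /andP[].
have BL y : y \in B -> 0 < x - y /\ x - y <= y.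
  rewrite mem_filter => /andP[yL yU]; split; first by apply/posA/LA.
  exact: LU.
have sB : one_separated B.
  apply: (@subseq_sorted _ (fun x y : R => x + 1 <= y)) ss.
    by move=> z y w /= yz zw; lra.
  exact: subseq_trans (filter_subseq _ _) (drop_subseq _ _).
(* With [E = 5 * D], the bound [40 * D < n] puts [2 * E] below all of [U], and
   [4 * E = 20 * D < K]. *)
apply: (@sum_product_separated R (sumset A) _ B
  (fun a b => (a + delta a b) * (b + delta' a b)) (5 * D)) => //.
- by move=> a b /BU/UA aA /BU/UA bA; apply: sumS.
- by move=> a b /BU/UA aA /BU/UA bA; apply/imfset2P; exists a => //; exists b.
- move=> a b aB bB; have [d1 d2] := dA _ _ (UA _ (BU _ aB)) (UA _ (BU _ bB)).
  have [a1 a2] := BL _ aB; have [b1 b2] := BL _ bB.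
  apply: (@product_error R D n%:R) => //; rewrite ?U_gt ?BU //; try lra.
- by move=> a /BU/U_gt; lra.
- lra.
Qed.

(** * Elimination of [N] and the final exponents *)

(** The fifth power of the first bound contains [N ^ 5], which the second eliminates;
    [8 ^ 5 * 400 <= 2 ^ 24] and [p ^ 2 * s ^ 7 <= (p + s) ^ 9]. *)
Lemma pow_sum_bound (n N s p K : nat) :
  (n ^ 2 <= 8 * (s * N) -> N ^ 5 <= 400 * (s ^ 2 * p ^ 2 * K) ->
   n ^ 10 <= 2 ^ 24 * K * (p + s) ^ 9)%N.
Proof.
move=> h1 h2.
rewrite (expnM n 2 5); apply: leq_trans (_ : (8 * (s * N)) ^ 5 <= _)%N.
  by rewrite leq_exp2r.
rewrite !expnMn; apply: leq_trans (leq_mul (leqnn _) (leq_mul (leqnn _) h2)) _.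
have -> : (8 ^ 5 * (s ^ 5 * (400 * (s ^ 2 * p ^ 2 * K))) =
  (8 ^ 5 * 400 * K) * (p ^ 2 * s ^ 7))%N by ring.
apply: leq_mul; first by rewrite leq_mul2r; apply/orP; right; lia.
by rewrite (expnD _ 2 7) leq_mul // leq_exp2r ?leq_addr ?leq_addl.
Qed.

Lemma powR_sub_le (R : realType) (n eps : R) : 1 <= n -> 0 < eps <= 1 ->
  1 <= n `^ (1 - eps) <= n.
Proof.
move=> n1 /andP[eps_gt0 eps_le1]; apply/andP; split.
  by rewrite -[leLHS](powRr0 n) ler_powR // subr_ge0.
by rewrite -[leRHS]powRr1 ?(le_trans ler01 n1) // ler_powR // gerBl ltW.
Qed.

(** Apply [ln (1 + y) <= y] with [1 + y = x^-1]. *)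
Lemma ln_ge_half (R : realType) (x : R) : 2 <= x -> 2^-1 <= ln x.
Proof.
move=> x2; have x0 : 0 < x by lra.
have xV : x^-1 <= 2^-1 by rewrite lef_pV2 ?posrE.
have xV0 : 0 < x^-1 by rewrite invr_gt0.
have := @le_ln1Dx R (x^-1 - 1); rewrite [1 + _]addrC subrK lnV ?posrE //.
by move=> /(_ _); lra.
Qed.

Theorem theorem1 (R : realType) (eps : R) (eps_gt0 : 0 < eps) (eps_le1 : eps <= 1) :
  exists (n0 : nat) (c : R), 0 < c /\
    forall (n : nat) (A : {fset R}) (delta delta' : R -> R -> R),
      (n0 < n)%N ->
      #|` A| = n ->
      (forall a, a \in A -> 0 < a) ->
      (forall a b, a \in A -> b \in A -> a != b -> 1 <= `|a - b|) ->
      (forall a b, a \in A -> b \in A ->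
         `|delta a b| < n%:R `^ (1 - eps) / a /\
         `|delta' a b| < n%:R `^ (1 - eps) / b) ->
      c * (n%:R `^ (1 + eps / 9) / ln n%:R)
        <= #|` perturbed_product A delta delta'|%:R + #|` sumset A|%:R.
Proof.
(* Exceeding [40]^ eps^-1[makes]n [^ eps > 40], that is [40 * D < n]. *)
pose n0 := (16 + (Num.truncn (40 `^ (eps^-1) : R)).+1)%N.
(* The factor 16 comes from [T_le], the factor 2 from [ln n >= 1/2]. *)
exists n0, 32^-1; split; first by rewrite invr_gt0.
move=> n A delta delta' n0n cardA posA sepA dA.
have n16 : (16 <= n)%N by apply: leq_trans (ltnW n0n); rewrite leq_addr.
have nR16 : (16 : R) <= n%:R by rewrite ler_nat.
have nR0 : 0 < n%:R :> R by lra.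
set D := n%:R `^ (1 - eps) in dA.
have D_bnd : 1 <= D <= n%:R by apply: powR_sub_le; [lra|apply/andP].
have D0 : 0 < D by case/andP: D_bnd; lra.
have nD : n%:R = D * n%:R `^ eps.
  rewrite /D -powRD ?subrK ?powRr1 ?ltW //; apply/implyP => _; exact: lt0r_neq0.
have D40 : 40 * D < n%:R.
  rewrite [ltRHS]nD mulrC ltr_pM2l //.
  have -> : (40 : R) = (40 `^ eps^-1) `^ eps.
    by rewrite -powRrM mulVf ?powRr1 // lt0r_neq0.
  apply: gt0_ltr_powR => //; rewrite ?nnegrE ?powR_ge0 ?ltW //.
  apply: lt_le_trans (truncnS_gt _) _; rewrite ler_nat.
  by apply: leq_trans (ltnW n0n); rewrite leq_addl.
pose K := (Num.truncn (20 * D)).+1.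
have K_gt : 20 * D < K%:R by exact: truncnS_gt.
have K_le : K%:R <= 21 * D.
  have : (Num.truncn (20 * D))%:R <= 20 * D by rewrite truncn_le mulr_ge0 ?ltW.
  rewrite /K -natr1.
  by case/andP: D_bnd; lra.
have [] := @sum_product_popular_fiber R A delta delta' D K; rewrite ?cardA //.
move=> N [N_s N_sp]; set s := #|` sumset A| in N_s N_sp *.
set p := #|` perturbed_product A delta delta'| in N_sp *.
have := pow_sum_bound N_s N_sp; rewrite -(ler_nat R) !(natrM, natrX, natrD) => bound.
set T := n%:R `^ (1 + eps / 9).
have T0 : 0 <= T by exact: powR_ge0.
(* The exponents add up: [9 * (1 + eps / 9) + (1 - eps) = 10]. *)
have T9 : T ^+ 9 * D = n%:R ^+ 10.
  rewrite -(powR_mulrn 9 T0) -(powR_mulrn 10 (ltW nR0)) /T -powRrM /D -powRD; last first.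
    by apply/implyP => _; exact: lt0r_neq0.
  by congr (_ `^ _); lra.
(* Compare ninth powers after multiplying by [D]; the constants fit because
   [2 ^ 24 * 21 <= 16 ^ 9]. *)
have T_le : T / 16 <= p%:R + s%:R.
  rewrite -(@ler_pXn2r R 9 isT) ?nnegrE ?addr_ge0 ?divr_ge0 //.
  rewrite exprMn exprVn ler_pdivrMr ?exprn_gt0 // -(ler_pM2r D0) T9.
  apply: le_trans bound _; set y := (_ + _) ^+ 9.
  have y0 : 0 <= y by rewrite exprn_ge0 ?addr_ge0.
  have -> : y * 16 ^+ 9 * D = 16 ^+ 9 * D * y by ring.
  rewrite ler_wpM2r //; apply: le_trans (ler_wpM2l _ K_le) _; first exact: exprn_ge0.
  rewrite mulrA ler_wpM2r ?ltW //.
  lra.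
have ln_n : 2^-1 <= ln n%:R :> R by apply: ln_ge_half; lra.
apply: le_trans T_le; rewrite mulrA ler_pdivrMr; last by lra.
have : 0 <= T * (ln n%:R - 2^-1) by rewrite mulr_ge0 // subr_ge0.
lra.
Qed.
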